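(* The continuous injection $\xi:\mathcal{B}(4,2)\to\mathscr{P}(4)$ sending the gauge class of $A=X\begin{pmatrix} K & 0 \\ M & 0 \end{pmatrix}X^*\in\mathcal{E}(4,2)$ to the pure state $\omega_K$ is not a topological embedding when $\mathscr{P}(4)$ is given the weak* topology.
   Context: $\mathbb{N}=\{1,2,\dots\}$. An MPS tensor of physical dimension $d$ and bond dimension $\chi$ is $K=(K^1,\dots,K^d)\in M_\chi(\mathbb{C})^d$; it is injective if $K^1,\dots,K^d$ span $M_\chi(\mathbb{C})$ and right-normalized if $\sum_i K^iK^{i*}=\mathbb{1}$. $\mathcal{I}(d,\chi)\subset M_\chi(\mathbb{C})^d$ is the subspace of right-normalized injective MPS tensors. $\mathcal{M}$ is the set of arrays $A=(A^i_{\alpha\beta})_{i,\alpha,\beta\in\mathbb{N}}$ of complex numbers with only finitely many nonzero entries, viewed as sequences of infinite matrices $A^i$. $\mathcal{M}(d,D)\subset\mathcal{M}$ consists of arrays with $A^i_{\alpha\beta}=0$ whenever $i>d$ or $\alpha>D$ or $\beta>D$ (a finite-dimensional vector space with its usual topology). $\mathrm{U}(\infty)=\bigcup_D\mathrm{U}(D)$ is the group of $\mathbb{N}\times\mathbb{N}$ matrices $\mathrm{diag}(X_0,1,1,\dots)$ with $X_0$ in some $\mathrm{U}(D)$. For $\chi\le D$, $\mathcal{E}(d,D,\chi)$ is the set of $A\in\mathcal{M}(d,D)$ of the form $A^i=X\begin{pmatrix} K^i & 0 \\ M^i & 0 \end{pmatrix}X^{-1}$ with $X\in\mathrm{U}(D)$,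 $K\in\mathcal{I}(d,\chi)$ and arbitrary complex $(D-\chi)\times\chi$ matrices $M^i$. $\mathcal{E}(d,D)=\bigcup_{\chi\le D}\mathcal{E}(d,D,\chi)$ has the subspace topology from $\mathcal{M}(d,D)$. $Q(A)$ is the orthogonal projection onto the range of $\sum_iA^{i*}A^i$. A gauge transformation of $A$ is $A^i\mapsto\lambda Z(A^i+\tilde A^i)Z^{-1}$ with $\lambda\in\mathrm{U}(1)$, $Z\in\mathrm{U}(\infty)$, and $\tilde A\in\mathcal{M}$ satisfying $Q(A)\tilde A^i=0$, $\tilde A^iQ(A)=\tilde A^i$ for all $i$; this gives an equivalence relation. $\mathcal{B}(d,D)$ is the set of gauge classes of elements of $\mathcal{E}(d,D)$ with the quotient topology. $\mathfrak{A}(d)$ is the quasi-local (UHF) $C^*$-algebra on the lattice $\mathbb{Z}$ with $M_d(\mathbb{C})$ at each site and $\mathscr{P}(d)$ its set of pure states. For $K\in\mathcal{I}(d,\chi)$ there is a unique positive invertible $T\in M_\chi(\mathbb{C})$ of trace one with $\sum_iK^{i*}TK^i=T$, and $\omega_K\in\mathscr{P}(d)$ is the translation invariant pure state determined, for $C_1,\dots,C_n\in M_d(\mathbb{C})$ placed on any $n$ consecutive sites, by $$\omega_K(C_1\otimes\cdots\otimes C_n)=\sum_{i_1,\dots,i_n,\,j_1,\dots,j_n}(C_1)_{i_1j_1}\cdots(C_n)_{i_nj_n}\,\mathrm{tr}\big(K^{i_n*}\cdots K^{i_1*}TK^{j_1}\cdots K^{j_n}\big).$$ The map $\xi$ is well-defined,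 continuous and injective. *)

(* Defs.v *)
From HB Require Import structures.
From mathcomp Require Import all_boot all_order all_algebra.
From mathcomp Require Import sesquilinear spectral generic_quotient.
From mathcomp Require Import complex.
From mathcomp Require Import all_classical all_reals.
From mathcomp Require Import topology normedtype.

Set Implicit Arguments.
Unset Strict Implicit.
Unset Printing Implicit Defensive.

Import Order.TTheory GRing.Theory Num.Theory.
Import numFieldNormedType.Exports.

Local Open Scope classical_set_scope.
Local Open Scope ring_scope.
Local Open Scope sesquilinear_scope.

(* Throughout, [C] stands for the field of complex numbers; it is instantiated
   by [R[i]] with [R : realType]. *)

Section Embedding.

Definition topological_embedding (X Y : topologicalType) (f : X -> Y) : Prop :=
  [/\ injective f, continuous f &
      forall U : set X, open U ->
        exists2 V : set Y, open V & f @` U = range f `&` V].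

End Embedding.

Section MPSTensors.
Variables (C : numClosedFieldType) (d chi : nat).

Definition mps_tensor := 'I_d -> 'M[C]_chi.

Definition injective_mps (K : mps_tensor) : Prop :=
  (<<codom K>> = {:'M[C]_chi})%VS.

Definition right_normalized (K : mps_tensor) : Prop :=
  \sum_(i < d) K i *m (K i)^t* = 1%:M.

Definition injective_mps_space : set mps_tensor :=
  [set K | injective_mps K /\ right_normalized K].

Definition psdmx (T : 'M[C]_chi) : Prop :=
  forall v : 'cV[C]_chi, 0 <= (v^t* *m T *m v) 0 0.

Definition mps_fixed_point (K : mps_tensor) (T : 'M[C]_chi) : Prop :=
  [/\ psdmx T, T \in unitmx, \tr T = 1 &
      \sum_(i < d) (K i)^t* *m T *m K i = T].

(* The value of omega_K on C_1 (x) ... (x) C_n, computed with the matrix T. *)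
Definition mps_correlation (K : mps_tensor) (T : 'M[C]_chi) (n : nat)
    (F : 'I_n -> 'M[C]_d) : C :=
  \sum_(i : {ffun 'I_n -> 'I_d}) \sum_(j : {ffun 'I_n -> 'I_d})
    (\prod_(k < n) F k (i k) (j k)) *
    \tr ((\big[mulmx/1%:M]_(k < n) (K (i (rev_ord k)))^t*) *m T *m
         (\big[mulmx/1%:M]_(k < n) K (j k))).

End MPSTensors.

Section InfiniteArrays.
Variable C : numClosedFieldType.

(* All indices, physical and virtual, are counted from 0. *)
Definition infmx := nat -> nat -> C.
Definition infvec := nat -> C.

(* [\sum_(k \in A)] is the sum over the finite support of the summand; all the
   sums below are finitely supported when one factor is a finite array or an
   element of [Uinf]. *)
Definition mulinf (X Y : infmx) : infmx :=
  fun a b => \sum_(k \in [set: nat]) X a k * Y k b.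

Definition adjinf (X : infmx) : infmx := fun a b => (X b a)^*.

Definition appinf (X : infmx) (v : infvec) : infvec :=
  fun a => \sum_(k \in [set: nat]) X a k * v k.

Definition finvec : set infvec := [set v | finite_set [set k | v k != 0]].

Definition dotinf (v w : infvec) : C := \sum_(k \in [set: nat]) (v k)^* * w k.

(* diag(X, 1, 1, ...) *)
Definition stabilize n (X : 'M[C]_n) : infmx := fun a b =>
  if (insub a, insub b) is (Some a', Some b') then X a' b' else (a == b)%:R.

Definition Uinf : set infmx :=
  [set Z | exists D (X : 'M[C]_D), X \is unitarymx /\ Z = stabilize X].

(* An array (A^i_{ab}) is a function of (i, a, b), with the topology of
   pointwise convergence; on the finite-dimensional space of arrays supported
   in i < d, a < D, b < D this is the usual vector space topology. *)
Definition array := {ptws (nat * nat * nat)%type -> C}.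

Definition slice (A : array) (i : nat) : infmx := fun a b => A (i, a, b).

Definition finarray : set array := [set A | finite_set [set p | A p != 0]].

Definition array_of d n (B : 'I_d -> 'M[C]_n) : array := fun p =>
  if (insub p.1.1, insub p.1.2, insub p.2) is (Some i, Some a, Some b)
  then B i a b else 0.

Definition gram (A : array) : infmx := fun a b =>
  \sum_(i \in [set: nat]) mulinf (adjinf (slice A i)) (slice A i) a b.

Definition range_inf (S : infmx) : set infvec := appinf S @` finvec.

Definition orthogonal_projection (V : set infvec) (Q : infmx) : Prop :=
  forall v, finvec v ->
    V (appinf Q v) /\
    forall w, V w -> dotinf w (fun k => v k - appinf Q v k) = 0.

(* [Q] is Q(A), and the inverse of the unitary Z is its adjoint. *)
Definition gauge (A A' : array) : Prop :=
  exists (lam : C) (Z : infmx) (At : array) (Q : infmx),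
    [/\ `|lam| = 1, Uinf Z, finarray At &
        orthogonal_projection (range_inf (gram A)) Q] /\
    forall i : nat,
      [/\ mulinf Q (slice At i) = (fun _ _ => 0),
          mulinf (slice At i) Q = slice At i &
          slice A' i = fun a b =>
            lam * mulinf (mulinf Z (fun a' b' => slice A i a' b' +
                                                 slice At i a' b'))
                         (adjinf Z) a b].

End InfiniteArrays.

Section ParameterSpace.
Variables (C : numClosedFieldType) (d : nat).

Definition mps_array chi m (X : 'M[C]_(chi + m)) (K : mps_tensor C d chi)
    (M : 'I_d -> 'M[C]_(m, chi)) : array C :=
  array_of (fun i => X *m block_mx (K i) 0 (M i) 0 *m invmx X).

Definition mps_space_rank (D chi : nat) : set (array C) :=
  [set A | exists m (X : 'M[C]_(chi + m)) K (M : 'I_d -> 'M[C]_(m, chi)),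
     [/\ (chi + m)%N = D, X \is unitarymx, injective_mps_space K &
         A = mps_array X K M]].

Definition mps_space (D : nat) : set (array C) :=
  \bigcup_(chi in [set chi | (0 < chi <= D)%N]) mps_space_rank D chi.

Definition gauge_class (D : nat) (A : mps_space D) : set (mps_space D) :=
  [set A' | gauge (\val A) (\val A')].

Definition gauge_classes (D : nat) : Type := set_type (range (@gauge_class D)).

Definition to_gauge_classes (D : nat) (A : mps_space D) : gauge_classes D :=
  exist _ (gauge_class A) (mem_set (imageT (@gauge_class D) A)).

Lemma to_gauge_classes_surj (D : nat) (c : gauge_classes D) :
  exists A, to_gauge_classes A = c.
Proof.
case: c => c cP; have [A _ AE] := set_mem cP.
by exists A; apply: val_inj.
Qed.

Definition gauge_classes_repr (D : nat) (c : gauge_classes D) : mps_space D :=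
  sval (cid (to_gauge_classes_surj c)).

Lemma gauge_classes_reprK (D : nat) :
  cancel (@gauge_classes_repr D) (@to_gauge_classes D).
Proof. by move=> c; exact: (svalP (cid (to_gauge_classes_surj c))). Qed.

HB.instance Definition _ (D : nat) :=
  isQuotient.Build (mps_space D) (gauge_classes D) (@gauge_classes_reprK D).

Definition mps_quotient (D : nat) : topologicalType :=
  quotient_topology (gauge_classes D).

Definition mps_class (D : nat) (A : mps_space D) : mps_quotient D :=
  to_gauge_classes A.

End ParameterSpace.

Arguments mps_space : clear implicits.

(* Unital C*-algebras. The product is a field of the structure because the
   hierarchies of rings and of normed modules meet only in number domains. *)
HB.mixin Record isCStar (C : numClosedFieldType) A
    of CompleteNormedModule C A := {
  cmul : A -> A -> A;
  cone : A;
  star : A -> A;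
  cmulA : associative cmul;
  cmul1x : left_id cone cmul;
  cmulx1 : right_id cone cmul;
  cmulDl : left_distributive cmul +%R;
  cmulDr : right_distributive cmul +%R;
  cscalerAl : forall (c : C) (x y : A), c *: cmul x y = cmul (c *: x) y;
  cscalerAr : forall (c : C) (x y : A), c *: cmul x y = cmul x (c *: y);
  cone_neq0 : cone != 0;
  starD : forall x y : A, star (x + y) = star x + star y;
  starZ : forall (c : C) (x : A), star (c *: x) = c^* *: star x;
  starM : forall x y : A, star (cmul x y) = cmul (star y) (star x);
  starK : involutive star;
  norm_cmul_le : forall x y : A, `|cmul x y| <= `|x| * `|y|;
  norm_starM : forall x : A, `|cmul (star x) x| = `|x| ^+ 2
}.

#[short(type="cstarAlgType")]
HB.structure Definition CStarAlgebra (C : numClosedFieldType) :=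
  { A of CompleteNormedModule C A & isCStar C A }.

HB.instance Definition _ (C : numClosedFieldType) (A : cstarAlgType C) :=
  Monoid.isLaw.Build A (@cone C A) (@cmul C A)
    (@cmulA C A) (@cmul1x C A) (@cmulx1 C A).

Local Notation "x ** y" := (cmul x y) (at level 40, left associativity).

Section QuasiLocal.
Variables (C : numClosedFieldType) (d : nat) (A : cstarAlgType C).
Variable site : int -> 'M[C]_d -> A.

(* C_1 (x) ... (x) C_n on the sites x, ..., x + n - 1 *)
Definition elementary_tensor (x : int) n (F : 'I_n -> 'M[C]_d) : A :=
  \big[cmul/cone]_(k < n) site (x + k%:Z) (F k).

(* The elements of the local algebras of the intervals [x, x + n - 1]. *)
Definition local_observables : set A :=
  [set a | exists x n N (c : 'I_N -> C) (F : 'I_N -> 'I_n -> 'M[C]_d),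
     a = \sum_(s < N) c s *: elementary_tensor x (F s)].

(* [A] is the quasi-local algebra with [site x] the embedding of the matrix
   algebra at [x]: commuting unital copies of 'M_d indexed by the integers
   generate the tensor products over finite intervals (the resulting maps on
   these tensor products are injective because they are simple algebras), and
   the union of these local algebras is norm dense. This determines
   [(A, site)] up to a unique isomorphism. *)
Definition quasilocal : Prop :=
  [/\ forall x (c : C) (F G : 'M[C]_d),
        site x (c *: F + G) = c *: site x F + site x G,
      forall x (F G : 'M[C]_d), site x (F *m G) = site x F ** site x G,
      forall x, site x 1%:M = cone &
      forall x (F : 'M[C]_d), site x (F^t*) = star (site x F)] /\
  [/\ forall x y (F G : 'M[C]_d), x != y ->
        site x F ** site y G = site y G ** site x F &
      closure local_observables = setT].

Definition state : set {ptws A -> C} :=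
  [set w | [/\ scalar w, forall a, 0 <= w (star a ** a),
               forall a, `|w a| <= `|a| & w cone = 1]].

(* The pointwise topology on functionals restricts to the weak* topology. *)
Definition pure_state : set {ptws A -> C} :=
  [set w | state w /\
     forall (w1 w2 : {ptws A -> C}) (t : C), state w1 -> state w2 ->
       0 < t < 1 -> (forall a, w a = t * w1 a + (1 - t) * w2 a) ->
       w1 = w /\ w2 = w].

(* [w] is omega_K: for K in [injective_mps_space], T exists and is unique. *)
Definition is_mps_state chi (K : mps_tensor C d chi) (w : A -> C) : Prop :=
  forall T, mps_fixed_point K T ->
    forall (x : int) n (F : 'I_n -> 'M[C]_d),
      w (elementary_tensor x F) = mps_correlation K T F.

End QuasiLocal.

Arguments pure_state : clear implicits.

(* Main.v *)
Require Import Defs.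
From HB Require Import structures.
From mathcomp Require Import all_boot all_order all_algebra.
From mathcomp Require Import sesquilinear spectral generic_quotient.
From mathcomp Require Import complex.
From mathcomp Require Import all_classical all_reals.
From mathcomp Require Import topology normedtype.
From mathcomp Require Import ring.

Import Order.TTheory GRing.Theory Num.Theory.
Import numFieldNormedType.Exports.

Local Open Scope classical_set_scope.
Local Open Scope ring_scope.
Local Open Scope complex_scope.

(* Injective tensors K_t of bond dimension 2 with K_t -> (1, 0, 0, 0) as t -> 0
   have states converging weak* to the product state of the bond dimension 1
   tensor (1, 0, 0, 0), because traces are all that is left of the bond space in
   the limit. But |tr A^0| is a continuous gauge invariant on E(4,2); it tends
   to 2 along K_t and equals 1 at the tensor of bond dimension 1, so the classes
   of K_t do not converge to the class of the latter. *)

(** * Finitely supported infinite matrices and their truncations *)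

Section TruncatedMatrices.
Local Open Scope sesquilinear_scope.
Context {C : numClosedFieldType}.
Implicit Types (X Y S Z Q : infmx C) (v : infvec C).

Definition supported_mx (n : nat) X : Prop :=
  forall a b, (n <= a)%N || (n <= b)%N -> X a b = 0.

Definition trunc_mx (n : nat) X : 'M[C]_n := \matrix_(a < n, b < n) X a b.

Definition trunc_vec (n : nat) v : 'cV[C]_n := \col_(k < n) v k.

(** Padding is by zero here, unlike [stabilize], which pads by the identity. *)
Definition extend_mx (n : nat) (P : 'M[C]_n) : infmx C := fun a b =>
  if (insub a, insub b) is (Some a', Some b') then P a' b' else 0.

Definition extend_vec (n : nat) (u : 'cV[C]_n) : infvec C := fun a =>
  if insub a is Some a' then u a' 0 else 0.

Lemma fsum_ord (n : nat) (f : nat -> C) :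
  (forall k, (n <= k)%N -> f k = 0) ->
  \sum_(k \in [set: nat]) f k = \sum_(k < n) f k.
Proof.
move=> f0; rewrite fsbig_ord; apply/esym/fsbig_widen => // k [_ /= /negP].
by rewrite -leqNgt => /f0.
Qed.

(** The hypothesis concerns products only, so one factor may have infinite support, like an element
    of [Uinf], as long as the other cuts off the sum. *)
Lemma trunc_mulinf (n : nat) X Y :
  (forall a b k, (n <= k)%N -> X a k * Y k b = 0) ->
  trunc_mx n (mulinf X Y) = trunc_mx n X *m trunc_mx n Y.
Proof.
move=> XY0; apply/matrixP => a b; rewrite !mxE /mulinf (fsum_ord n).
  by apply: eq_bigr => k _; rewrite !mxE.
by move=> k; exact: XY0.
Qed.

Lemma trunc_adjinf (n : nat) X : trunc_mx n (adjinf X) = (trunc_mx n X)^t*.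
Proof. by apply/matrixP => a b; rewrite !mxE. Qed.

Lemma extend_mxE (n : nat) (P : 'M[C]_n) (a b : 'I_n) : extend_mx n P a b = P a b.
Proof. by rewrite /extend_mx !valK. Qed.

Lemma extend_vecE (n : nat) (u : 'cV[C]_n) (a : 'I_n) : extend_vec n u a = u a 0.
Proof. by rewrite /extend_vec valK. Qed.

Lemma extend_vec_ge (n : nat) (u : 'cV[C]_n) a : (n <= a)%N -> extend_vec n u a = 0.
Proof. by move=> na; rewrite /extend_vec insubN// -leqNgt. Qed.

Lemma supported_extend (n : nat) (P : 'M[C]_n) : supported_mx n (extend_mx n P).
Proof.
move=> a b; rewrite /extend_mx; case: insubP => //= a' an _.
by case: insubP => //= b' bn _; rewrite leqNgt an leqNgt bn.
Qed.

Lemma extend_vecP (n : nat) (v w : infvec C) : (forall a : 'I_n, v a = w a) ->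
  (forall a, (n <= a)%N -> v a = w a) -> v = w.
Proof.
move=> vw vw'; apply/funext => a; have [/vw'//|an] := leqP n a.
exact: (vw (Ordinal an)).
Qed.

Lemma finvec_extend (n : nat) (u : 'cV[C]_n) : finvec (extend_vec n u).
Proof.
apply: (@sub_finite_set _ _ `I_n) => // a /= ua.
by rewrite ltnNge; apply: contra ua => /extend_vec_ge ->.
Qed.

Lemma appinf_supported (n : nat) S v : supported_mx n S ->
  appinf S v = extend_vec n (trunc_mx n S *m trunc_vec n v).
Proof.
move=> Sn; apply: (extend_vecP n) => a; last first.
  move=> na; rewrite extend_vec_ge// /appinf fsbig1// => k _.
  by rewrite Sn ?mul0r// na.
rewrite extend_vecE mxE /appinf (fsum_ord n) => [|k nk].
  by apply: eq_bigr => k _; rewrite !mxE.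
by rewrite Sn ?mul0r// nk orbT.
Qed.

Lemma trunc_extend_vec (n : nat) (u : 'cV[C]_n) : trunc_vec n (extend_vec n u) = u.
Proof. by apply/colP => a; rewrite mxE extend_vecE. Qed.

Lemma trunc_extend_mx (n : nat) (P : 'M[C]_n) : trunc_mx n (extend_mx n P) = P.
Proof. by apply/matrixP => a b; rewrite mxE extend_mxE. Qed.

Lemma mxtrace_trunc_widen (n N : nat) X : (n <= N)%N -> supported_mx n X ->
  \tr (trunc_mx N X) = \tr (trunc_mx n X).
Proof.
move=> nN Xn; rewrite /mxtrace.
under eq_bigr do rewrite mxE; under [RHS]eq_bigr do rewrite mxE.
by rewrite -!(fsum_ord _ (fun k => X k k)) // => k nk;
  rewrite Xn // ?nk // (leq_trans nN).
Qed.

(* On the range of a Hermitian G = U^* diag(s) U the orthogonal projection is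
   U^* diag(s s^-1) U, with the convention 0^-1 = 0. *)
Lemma hermitian_range_projection (n : nat) (G : 'M[C]_n) : G^t* = G ->
  exists P Y : 'M[C]_n, G *m Y = P /\ G *m P = G.
Proof.
move=> Gh; have /orthomx_spectralP : G \is normalmx by apply/normalmxP; rewrite Gh.
set U := spectralmx _; set s := spectral_diag _ => GE.
have Uu : U \in unitmx by exact: spectral_unit.
pose s' : 'rV_n := \row_k (s 0 k)^-1.
exists (invmx U *m (diag_mx s *m diag_mx s') *m U), (invmx U *m diag_mx s' *m U).
have M (A B : 'M[C]_n) :
    (invmx U *m A *m U) *m (invmx U *m B *m U) = invmx U *m (A *m B) *m U.
  by rewrite !mulmxA mulmxK.
rewrite GE !M; split=> //; congr (_ *m _ *m _).
rewrite !mulmx_diag; congr diag_mx; apply/rowP => k; rewrite !mxE.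
by have [->|s0] := eqVneq (s 0 k) 0; rewrite ?mul0r// mulfV// mulr1.
Qed.

(** Supplies the [Q] that [gauge] demands. With [G] the truncation of [S], [G Y = P] puts [P v] in
    the range, and [G P = G] with [G] Hermitian gives [<G u, v - P v> = <u, (G - G P) v> = 0]. *)
Lemma orthogonal_projection_exists (n : nat) S :
  supported_mx n S -> (trunc_mx n S)^t* = trunc_mx n S ->
  exists Q, orthogonal_projection (range_inf S) Q.
Proof.
move=> Sn Sh; have [P [Y [GY GP]]] := hermitian_range_projection n _ Sh.
exists (extend_mx n P) => v vfin.
rewrite (appinf_supported n (extend_mx n P))//; last exact: supported_extend.
rewrite trunc_extend_mx; split.
  exists (extend_vec n (Y *m trunc_vec n v)); first exact: finvec_extend.
  by rewrite (appinf_supported n)// trunc_extend_vec mulmxA GY.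
move=> _ [u _ <-]; rewrite (appinf_supported n)// /dotinf (fsum_ord n); last first.
  by move=> k nk; rewrite extend_vec_ge// conjC0 mul0r.
set G := trunc_mx n S in Sh GY GP *.
have : (G *m trunc_vec n u)^t* *m (trunc_vec n v - P *m trunc_vec n v) = 0.
  by rewrite trmx_mul map_mxM Sh -mulmxA mulmxBr mulmxA GP subrr mulmx0.
move/matrixP/(_ 0 0); rewrite mxE [RHS]mxE; apply: etrans.
by apply: eq_bigr => k _; rewrite !extend_vecE !mxE.
Qed.

(** A cut-off at or beyond [D] leaves the block matrix [diag(X, 1)]. *)
Lemma trunc_stabilize_unitary (D m : nat) (X : 'M[C]_D) : X \is unitarymx ->
  trunc_mx (D + m) (stabilize X) \is unitarymx.
Proof.
move=> /unitarymxP XX.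
have -> : trunc_mx (D + m) (stabilize X) = block_mx X 0 0 1%:M.
  apply/matrixP => a b; rewrite mxE /stabilize.
  rewrite -[a]fintype.splitK -[b]fintype.splitK.
  case: (fintype.split a) => a'; case: (fintype.split b) => b' /=.
  - by rewrite block_mxEul !valK.
  - by rewrite block_mxEur mxE valK insubN ?ltn_eqF//= -?leqNgt ?leq_addr// ltn_addr.
  - rewrite block_mxEdl mxE valK insubN //= -?leqNgt ?leq_addr// gtn_eqF//.
    by rewrite ltn_addr.
  - by rewrite block_mxEdr mxE insubN//= -?leqNgt ?leq_addr// eqn_add2l.
apply/unitarymxP; rewrite tr_block_mx map_block_mx !trmx0 !map_mx0 mulmx_block.
rewrite XX !mulmx0 !mul0mx !addr0 add0r trmx1 map_mx1 mulmx1.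
by rewrite scalar_mx_block.
Qed.

Lemma finarray_supported (A : array C) : finarray A ->
  exists N, forall i, supported_mx N (slice A i).
Proof.
move=> /finite_seqP[s sE].
(* The successor of the largest virtual index in the support bounds all slices at once. *)
exists (\max_(p <- s) maxn p.1.2 p.2).+1 => i a b.
apply: contraTeq => Aab.
have ps : (i, a, b) \in s by move/seteqP: sE => [+ _]; apply.
have := @leq_bigmax_seq _ _ xpredT (fun p => maxn p.1.2 p.2) _ ps isT.
by rewrite geq_max => /andP[/= am bm]; rewrite negb_or -!ltnNge !ltnS am.
Qed.

(* The corner At has trace zero because At = At Q while Q At = 0. *)
Lemma gauge_norm_trace (n i : nat) (A A' : array C) :
  supported_mx n (slice A i) -> supported_mx n (slice A' i) -> gauge A A' ->
  `|\tr (trunc_mx n (slice A' i))| = `|\tr (trunc_mx n (slice A i))|.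
Proof.
move=> An A'n [lam [Z [At [Q [[lam1 [D [X [Xu ZE]]] Atfin _] /(_ i)]]]]].
move=> [QAt AtQ A'E]; have [N0 AtN0] := finarray_supported _ Atfin.
(* [N] dominates the block size [D] of the unitary, the size [n] of both arrays and the support of
   [At]. *)
pose m := maxn n N0; pose N := (D + m)%N.
have nN : (n <= N)%N by rewrite /N (leq_trans (leq_maxl n N0))// leq_addl.
have N0N : (N0 <= N)%N by rewrite /N (leq_trans (leq_maxr n N0))// leq_addl.
have widen k Y : (k <= N)%N -> supported_mx k Y -> supported_mx N Y.
  by move=> kN Yk a b /orP[]/(leq_trans kN) h; apply: Yk; rewrite h ?orbT.
have AtN := widen _ _ N0N (AtN0 i); have AN := widen _ _ nN An.
rewrite -(mxtrace_trunc_widen n N _ nN A'n) -(mxtrace_trunc_widen n N _ nN An).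
set B := fun a b => slice A i a b + slice At i a b in A'E.
have BN : supported_mx N B by move=> a b h; rewrite /B AN// AtN// addr0.
have BE : trunc_mx N B = trunc_mx N (slice A i) + trunc_mx N (slice At i).
  by apply/matrixP => a b; rewrite !mxE.
have At0 : \tr (trunc_mx N (slice At i)) = 0.
  (* [Q] may be an infinite matrix, but [At] cuts off both products, so cyclicity of the finite
     trace applies. *)
  rewrite -{1}AtQ trunc_mulinf => [|a b k Nk]; last by rewrite AtN ?mul0r// Nk orbT.
  rewrite mxtrace_mulC -trunc_mulinf => [|a b k Nk]; last by rewrite AtN ?mulr0// Nk.
  by rewrite QAt /mxtrace big1// => k _; rewrite mxE.
have -> : trunc_mx N (slice A' i) =
    lam *: (trunc_mx N Z *m trunc_mx N B *m (trunc_mx N Z)^t*).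
  rewrite -trunc_adjinf -trunc_mulinf => [|a b k Nk]; last by rewrite BN ?mulr0// Nk.
  rewrite -trunc_mulinf => [|a b k Nk]; first by apply/matrixP => a b; rewrite !mxE A'E.
  rewrite [mulinf _ _ a k]fsbig1 ?mul0r// => j _.
  by rewrite BN ?mulr0// Nk orbT.
have := @trunc_stabilize_unitary D m X Xu; rewrite -ZE => /unitarymxP/mulmx1C Zu.
by rewrite mxtraceZ mxtrace_mulC mulmxA Zu mul1mx BE mxtraceD At0 addr0 normrM lam1 mul1r.
Qed.

End TruncatedMatrices.

(** * The trace invariant on the quotient space *)

Section GaugeClasses.
Local Open Scope sesquilinear_scope.
Context {C : numClosedFieldType}.

Lemma supported_array_of (d n : nat) (B : 'I_d -> 'M[C]_n) i :
  supported_mx n (slice (array_of B) i).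
Proof.
move=> a b; rewrite /slice /array_of /=; case: insubP => //= i' _ _.
by case: insubP => //= a' an _; case: insubP => //= b' bn _; rewrite leqNgt an leqNgt bn.
Qed.

Lemma trunc_array_of (d n : nat) (B : 'I_d -> 'M[C]_n) (i : 'I_d) :
  trunc_mx n (slice (array_of B) i) = B i.
Proof. by apply/matrixP => a b; rewrite mxE /slice /array_of /= !valK. Qed.

Lemma slice_array_of_ge (d n : nat) (B : 'I_d -> 'M[C]_n) i : (d <= i)%N ->
  slice (array_of B) i = fun _ _ => 0.
Proof.
move=> di; apply/funext => a; apply/funext => b.
by rewrite /slice /array_of /= insubN// -leqNgt.
Qed.

Lemma fsum_only (f : nat -> C) a :
  (forall k, k != a -> f k = 0) -> \sum_(k \in [set: nat]) f k = f a.
Proof.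
move=> f0; rewrite -[RHS](@fsbig_set1 _ _ +%R); apply/esym/fsbig_widen => // k [_ /=] /eqP.
exact: f0.
Qed.

Lemma supported_gram (d n : nat) (B : 'I_d -> 'M[C]_n) :
  supported_mx n (gram (array_of B)).
Proof.
move=> a b nab; rewrite /gram fsbig1// => i _; rewrite /mulinf fsbig1// => k _.
have /orP[na|nb] := nab.
  by rewrite /adjinf supported_array_of ?conjC0 ?mul0r// na orbT.
by rewrite [X in _ * X]supported_array_of ?mulr0// nb orbT.
Qed.

Lemma trunc_gram (d n : nat) (B : 'I_d -> 'M[C]_n) :
  trunc_mx n (gram (array_of B)) = \sum_(i < d) (B i)^t* *m B i.
Proof.
apply/matrixP => a b; rewrite mxE /gram (fsum_ord d) => [|i di]; last first.
  by rewrite slice_array_of_ge// /mulinf fsbig1// => k _; rewrite mulr0.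
rewrite summxE; apply: eq_bigr => i _.
rewrite -(trunc_array_of _ _ B i) -trunc_adjinf -trunc_mulinf ?mxE// => x y k nk.
by rewrite [X in _ * X]supported_array_of ?mulr0// nk.
Qed.

(** Classes are sets of gauge transforms, so reflexivity is what extracts an actual gauge
    transformation from an equality of classes. The trivial transformation works once some
    projection [Q] exists. *)
Lemma gauge_refl (d n : nat) (B : 'I_d -> 'M[C]_n) :
  gauge (array_of B) (array_of B).
Proof.
have [|Q QP] := @orthogonal_projection_exists C n _ (supported_gram _ _ B).
  rewrite trunc_gram raddf_sum /= map_mx_sum; apply: eq_bigr => i _.
  rewrite trmx_mul map_mxM; congr (_ *m _).
  by apply/matrixP => a b; rewrite !mxE /= conjCK.
pose Z : infmx C := fun a b => (a == b)%:R.
exists 1, Z, (fun=> 0), Q; split.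
  split=> //; first by rewrite normr1.
  (* The infinite identity is the stabilization of the empty matrix. *)
  - exists 0%N, 1%:M; split; first by apply/unitarymxP/matrixP => -[].
    by apply/funext => a; apply/funext => b; rewrite /stabilize insubN.
  - by apply: (@sub_finite_set _ _ set0) => // p /=; rewrite eqxx.
move=> i; split.
- by apply/funext=> a; apply/funext=> b; rewrite /mulinf fsbig1// => k _; rewrite mulr0.
- by apply/funext=> a; apply/funext=> b; rewrite /mulinf fsbig1// => k _; rewrite mul0r.
apply/funext => a; apply/funext => b; rewrite mul1r {1}/mulinf (fsum_only _ b).
  rewrite /adjinf /Z eqxx conjC1 mulr1 /mulinf (fsum_only _ a).
    by rewrite eqxx mul1r /slice addr0.
  by move=> k ka; rewrite eq_sym (negbTE ka) mul0r.
by move=> k kb; rewrite /adjinf /Z eq_sym (negbTE kb) conjC0 mulr0.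
Qed.

Lemma mps_space_array_of (d D : nat) (A : array C) : mps_space C d D A ->
  exists B : 'I_d -> 'M[C]_D, A = array_of B.
Proof.
move=> [chi _ [m [X [K [M [DE _ _ ->]]]]]]; subst D.
by exists (fun i => X *m block_mx (K i) 0 (M i) 0 *m invmx X).
Qed.

(** The modulus absorbs the phase [lam] of a gauge transformation. *)
Definition trace_norm (d D : nat) (a : mps_space C d D) : C :=
  `|\tr (trunc_mx D (slice (\val a) 0))|.

(** [b] lies in its own class, hence in that of [a], which makes it a gauge transform of [a]. *)
Lemma trace_norm_class (d D : nat) (a b : mps_space C d D) :
  mps_class a = mps_class b -> trace_norm d D a = trace_norm d D b.
Proof.
move=> [ab]; have [Ba aE] := mps_space_array_of _ _ _ (set_mem (valP a)).
have [Bb bE] := mps_space_array_of _ _ _ (set_mem (valP b)).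
have : gauge_class b b by rewrite /gauge_class /= bE; exact: gauge_refl.
rewrite -ab => /gauge_norm_trace; rewrite /trace_norm => -> //.
- by rewrite aE; exact: supported_array_of.
- by rewrite bE; exact: supported_array_of.
Qed.

(** An existential over representatives, since [trace_norm] lives on arrays; by gauge invariance all
    representatives give the same answer. *)
Definition small_trace (d D : nat) (r : C) : set (mps_quotient C d D) :=
  [set c | exists2 a, mps_class a = c & trace_norm d D a < r].

Lemma small_traceE (d D : nat) (r : C) (a : mps_space C d D) :
  small_trace d D r (mps_class a) = (trace_norm d D a < r) :> Prop.
Proof.
by apply/propext; split=> [[b /trace_norm_class -> //]|ar]; exists a.
Qed.

Lemma pi_mps_quotient (d D : nat) (a : mps_space C d D) :
  (\pi_(mps_quotient C d D) a)%qT = mps_class a.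
Proof. by rewrite /= unlock. Qed.

Lemma continuous_set_val_eval (d D : nat) p :
  continuous (fun a : mps_space C d D => \val a p).
Proof.
move=> a; apply: (@continuous_comp _ _ _ (fun a : mps_space C d D => \val a) (fun A : array C => A p)).
  exact: initial_continuous.
exact: proj_continuous.
Qed.

(** By gauge invariance the preimage in the space of arrays is the locus where the trace of slice 0
    lies in a disc, and that trace is a finite sum of coordinates. *)
Lemma open_small_trace (d D : nat) (r : C) : open (small_trace d D r).
Proof.
rewrite /open /= /quotient_open.
pose f (a : mps_space C d D) := \sum_(k < D) \val a (0%N, k : nat, k : nat).
have cf : continuous f.
  by apply: (continuous_big add_continuous) => k _; exact: continuous_set_val_eval.
suff -> : (\pi_(mps_quotient C d D) @^-1` small_trace d D r)%qT = f @^-1` ball 0 r.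
  by apply: open_comp; [move=> ? _; exact: cf|exact: ball_open].
apply/seteqP; split => a /=; rewrite pi_mps_quotient small_traceE /trace_norm;
  rewrite -ball_normE /= sub0r normrN /mxtrace;
  by under eq_bigr do rewrite mxE.
Qed.
End GaugeClasses.

(** * Correlations as polynomials in scalar coefficients *)

Section Correlations.
Local Open Scope sesquilinear_scope.
Context {C : numClosedFieldType}.

Lemma bigmulmx_scale (chi : nat) (I : Type) (r : seq I) (k : I -> C)
    (S : I -> 'M[C]_chi) :
  \big[mulmx/1%:M]_(i <- r) (k i *: S i) =
  (\prod_(i <- r) k i) *: \big[mulmx/1%:M]_(i <- r) S i.
Proof.
elim: r => [|i r IH]; first by rewrite !big_nil scale1r.
by rewrite !big_cons IH -scalemxAl -scalemxAr scalerA.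
Qed.

Lemma mps_correlation_scale (d chi n : nat) (k : 'I_d -> C)
    (S : mps_tensor C d chi) (T : 'M[C]_chi) (F : 'I_n -> 'M[C]_d) :
  mps_correlation (fun j => k j *: S j) T F =
  \sum_(i : {ffun 'I_n -> 'I_d}) \sum_(j : {ffun 'I_n -> 'I_d})
    (\prod_(l < n) F l (i l) (j l)) *
    ((\prod_(l < n) (k (i (rev_ord l)))^*) * (\prod_(l < n) k (j l)) *
     \tr ((\big[mulmx/1%:M]_(l < n) (S (i (rev_ord l)))^t*) *m T *m
          (\big[mulmx/1%:M]_(l < n) S (j l)))).
Proof.
apply: eq_bigr => i _; apply: eq_bigr => j _; congr (_ * _).
under eq_bigr do rewrite linearZ /= map_mxZ.
by rewrite !bigmulmx_scale -!scalemxAl -scalemxAr scalerA mxtraceZ.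
Qed.

(** The trace factor collapses to [\tr T = 1], so the value depends on neither [chi] nor [T]; this
    lets tensors of different bond dimensions be compared. *)
Lemma mps_correlation_scalar (d chi n : nat) (k : 'I_d -> C) (T : 'M[C]_chi)
    (F : 'I_n -> 'M[C]_d) :
  \tr T = 1 ->
  mps_correlation (fun j => (k j)%:M : 'M_chi) T F =
  \sum_(i : {ffun 'I_n -> 'I_d}) \sum_(j : {ffun 'I_n -> 'I_d})
    (\prod_(l < n) F l (i l) (j l)) *
    ((\prod_(l < n) (k (i (rev_ord l)))^*) * (\prod_(l < n) k (j l))).
Proof.
move=> trT.
have -> : (fun j => (k j)%:M : 'M_chi) = (fun j => k j *: (1%:M : 'M_chi)).
  by apply/funext => j; rewrite scalemx1.
rewrite (mps_correlation_scale _ _ _ _ (fun=> 1%:M)).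
apply: eq_bigr => i _; apply: eq_bigr => j _; congr (_ * _).
have big1M : \big[mulmx/1%:M]_(l < n) 1%:M = 1%:M :> 'M[C]_chi.
  by elim/big_ind: _ => // ? ? -> ->; rewrite mulmx1.
by rewrite trmx1 map_mx1 !big1M mul1mx mulmx1 trT mulr1.
Qed.

(** A correlation is a polynomial in the coefficients and their conjugates, [S] and [T] being
    fixed. *)
Lemma cvg_mps_correlation_scale (U : Type) (G : set_system U) (d chi n : nat)
    (k : U -> 'I_d -> C) (k0 : 'I_d -> C) (S : mps_tensor C d chi)
    (T : 'M[C]_chi) (F : 'I_n -> 'M[C]_d) :
  Filter G ->
  (forall j, k u j @[u --> G] --> k0 j) ->
  (forall j, ((k u j)^*)%R @[u --> G] --> ((k0 j)^*)%R) ->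
  mps_correlation (fun j => k u j *: S j) T F @[u --> G] -->
  mps_correlation (fun j => k0 j *: S j) T F.
Proof.
move=> GF kk0 kk0C; rewrite mps_correlation_scale.
under eq_cvg do rewrite mps_correlation_scale.
apply: (cvg_big add_continuous) => i _; apply: (cvg_big add_continuous) => j _.
apply: cvgM; first exact: cvg_cst.
apply: cvgM; last exact: cvg_cst.
by apply: cvgM; apply: (cvg_big mul_continuous).
Qed.

End Correlations.

(** * Weak* convergence of states tested on local observables *)

Section QuasiLocalStates.
Context {C : numClosedFieldType} {d : nat} {A : cstarAlgType C}.
Variable site : int -> 'M[C]_d -> A.

Lemma state0 (v : {ptws A -> C}) : @state C A v -> v 0 = 0.
Proof.
move=> [/(_ 1 0 0)]; rewrite /= scale1r addr0 mul1r => v0 _ _ _.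
by apply: (addrI (v 0)); rewrite addr0 -v0.
Qed.

Lemma state_sub (v : {ptws A -> C}) a b : @state C A v -> v (a - b) = v a - v b.
Proof. by move=> [/(_ (-1) b a) + _ _ _]; rewrite /= scaleN1r mulN1r [a - b]addrC => ->; rewrite addrC. Qed.

(* The bound |w a| <= |a| makes states equicontinuous, so that pointwise
   convergence only has to be tested on a dense set. *)
Lemma cvg_state_dense (U : Type) (G : set_system U) (D : set A)
    (w : U -> {ptws A -> C}) (w0 : {ptws A -> C}) :
  Filter G -> closure D = setT -> @state C A w0 -> (forall u, @state C A (w u)) ->
  (forall b, D b -> w u b @[u --> G] --> w0 b) ->
  w u @[u --> G] --> w0.
Proof.
move=> GF Dd w0s ws wD.
apply/pointwise_cvgP => a; suff: w u a @[u --> G] --> w0 a by [].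
apply/cvgrPdist_lt => e e0.
have e3 : 0 < e / 3 by rewrite divr_gt0.
have : closure D a by rewrite Dd.
move=> /(_ (ball a (e / 3)))[]; first exact: nbhsx_ballx.
move=> b [Db]; rewrite -ball_normE /= => ab.
have lip v : @state C A v -> `|v a - v b| < e / 3.
  move=> vs; have [_ _ vb _] := vs; apply: le_lt_trans ab.
  by rewrite -state_sub.
have /cvgrPdist_lt/(_ _ e3) := wD b Db.
apply: filterS => u wub.
(* The difference at [a] is routed through [b]: two contraction errors and one convergence error,
   each below [e / 3]. *)
rewrite (_ : w0 a - w u a = (w0 a - w0 b) + (w0 b - w u b) - (w u a - w u b)); last by ring.
have -> : e = e / 3 + e / 3 + e / 3 by field.
apply: le_lt_trans (ler_normB _ _) _; rewrite ltrD ?lip//.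
by apply: le_lt_trans (ler_normD _ _) _; rewrite ltrD ?lip.
Qed.

(** Local observables are norm dense finite combinations of elementary tensors, so linearity reduces
    the claim to [cvg_state_dense]. *)
Lemma cvg_state_local (U : Type) (G : set_system U)
    (w : U -> {ptws A -> C}) (w0 : {ptws A -> C}) :
  Filter G -> quasilocal site -> @state C A w0 -> (forall u, @state C A (w u)) ->
  (forall x n (F : 'I_n -> 'M[C]_d),
     w u (elementary_tensor site x F) @[u --> G] --> w0 (elementary_tensor site x F)) ->
  w u @[u --> G] --> w0.
Proof.
move=> GF [_ [_ dense]] w0s ws wF; apply: (cvg_state_dense _ _ _ _ _ GF dense) => //.
move=> _ [x [n [N [c [F ->]]]]].
have lin v : @state C A v -> v (\sum_(s < N) c s *: elementary_tensor site x (F s)) =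
    \sum_(s < N) c s * v (elementary_tensor site x (F s)).
  move=> vs; elim/big_rec2: _ => [|s y z _ <-]; first exact: state0.
  by have [-> _ _ _] := vs.
rewrite lin//; under eq_cvg do rewrite lin//.
apply: (cvg_big add_continuous) => s _.
by apply: cvgM; [exact: cvg_cst|exact: wF].
Qed.
End QuasiLocalStates.

(** * A family of injective tensors degenerating to a product tensor *)

Section SmallPerturbations.
Local Open Scope sesquilinear_scope.
Context {C : numClosedFieldType}.

Lemma cvg_conjC (U : Type) (G : set_system U) (f : U -> C) (l : C) :
  Filter G -> f u @[u --> G] --> l -> ((f u)^*)%R @[u --> G] --> (l^*)%R.
Proof.
move=> GF fl; apply/cvgrPdist_lt => e e0.
by move/cvgrPdist_lt/(_ e e0): fl; apply: filterS => u; rewrite -rmorphB norm_conjC.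
Qed.

(* X^p Z^q for the Pauli matrices X and Z, where j = 2 p + q. *)
Definition weyl_basis (j : 'I_4) : 'M[C]_2 :=
  \matrix_(a < 2, b < 2) (if odd (a + b) == (1 < j)%N then
     (-1) ^+ (odd j && odd b) else 0).

Lemma weyl_basis0 : weyl_basis 0 = 1%:M.
Proof.
by apply/matrixP => -[[|[|//]] ?] [[|[|//]] ?]; rewrite !mxE /= ?expr0.
Qed.

Lemma weyl_basis_adj_mul j : (weyl_basis j)^t* *m weyl_basis j = 1%:M.
Proof.
apply/matrixP => -[[|[|//]] ?] [[|[|//]] ?]; rewrite !mxE !big_ord_recl big_ord0 !mxE /=;
  case: j => [[|[|[|[|//]]]] ?] /=;
  rewrite ?expr0 ?expr1 ?conjC0 ?conjC1 ?rmorphN1 ?mulr0 ?mul0r ?mulr1 ?mulrNN ?addr0 ?add0r ?mulr1 ?subrr//.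
Qed.

Lemma weyl_basis_mul_adj j : weyl_basis j *m (weyl_basis j)^t* = 1%:M.
Proof. exact/mulmx1C/weyl_basis_adj_mul. Qed.

(** The four matrices are real and orthogonal for the trace form, each of square norm 2; hence a
    transpose instead of an adjoint, and the division by 2. *)
Lemma weyl_basis_expansion (M : 'M[C]_2) :
  M = \sum_j (\tr ((weyl_basis j)^T *m M) / 2) *: weyl_basis j.
Proof.
pose f a b : C := M (inord a) (inord b).
have {1 2}-> : M = \matrix_(a, b) f a b by apply/matrixP => a b; rewrite mxE /f !inord_val.
apply/matrixP => -[[|[|//]] ?] [[|[|//]] ?];
  rewrite summxE !big_ord_recl big_ord0 !mxE /mxtrace !big_ord_recl !big_ord0;
  rewrite !mxE !big_ord_recl !big_ord0 !mxE /= /bump /=; by field.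
Qed.

(* A rational parametrization of |c 0|^2 + |c 1|^2 + |c 2|^2 + |c 3|^2 = 1. *)
Definition twist_coef (t : C) (j : 'I_4) : C :=
  (if j == 0 then 1 - 3 * (t * t) else 2 * t) / (1 + 3 * (t * t)).

(** At [t = 0] this is the identity matrix followed by three zeros: injectivity is lost, and the
    trace of slice 0 is 2. *)
Definition twist_mps (t : C) : mps_tensor C 4 2 :=
  fun j => twist_coef t j *: weyl_basis j.

Definition product_mps : mps_tensor C 4 1 := fun j => (j == 0)%:R%:M.

Lemma twist_coef_norm (t : C) : 0 < t ->
  \sum_j (twist_coef t j)^* * twist_coef t j = 1.
Proof.
(* In the order of [C] a positive [t] is real, so conjugation fixes the coefficients. *)
move=> t0; have tr := gtr0_real t0.
have d0 : 1 + 3 * (t * t) != 0 by rewrite gt_eqF// addr_gt0// !mulr_gt0.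
under eq_bigr => j _.
  have -> : (twist_coef t j)^*%R = twist_coef t j.
    apply: conj_Creal; rewrite /twist_coef.
    by case: ifP => _; rewrite rpred_div ?rpredB ?rpredD ?rpredM ?rpred1 ?rpred_nat.
  over.
rewrite !big_ord_recl big_ord0 /twist_coef /=.
by field.
Qed.

(** The bound 1/2 keeps [3 t^2] below 3/4, so the numerator [1 - 3 t^2] stays positive. *)
Lemma twist_coef_neq0 (t : C) j : 0 < t -> t < 1 / 2 -> twist_coef t j != 0.
Proof.
move=> t0 t2.
have d0 : 1 + 3 * (t * t) != 0 by rewrite gt_eqF// addr_gt0// !mulr_gt0.
rewrite /twist_coef mulf_neq0 ?invr_eq0//; case: ifP => _.
  rewrite gt_eqF// subr_gt0.
  have : 3 * (t * t) < 3 * (1 / 2 * (1 / 2)).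
    by rewrite ltr_pM2l// ltr_pM// ltW.
  move/lt_trans; apply.
  rewrite -subr_gt0 (_ : _ - _ = 1 / 4) ?divr_gt0//.
  by field.
by rewrite mulf_neq0// gt_eqF.
Qed.

(** Both orders of a unitary times its adjoint fit [B]: one gives right normalization, the other the
    fixed point. *)
Lemma sum_scale_unitary (t : C) (B : 'I_4 -> 'M[C]_2) : 0 < t ->
  (forall j, B j = 1%:M) -> \sum_j ((twist_coef t j)^* * twist_coef t j) *: B j = 1%:M.
Proof.
by move=> t0 B1; under eq_bigr do rewrite B1; rewrite -scaler_suml twist_coef_norm// scale1r.
Qed.

Lemma injective_twist_mps (t : C) : 0 < t -> t < 1 / 2 ->
  injective_mps_space (twist_mps t).
Proof.
move=> t0 t2; split.
  rewrite /injective_mps; apply/eqP; rewrite eqEsubv subvf /=; apply/subvP => M _.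
  rewrite (weyl_basis_expansion M); apply: memv_suml => j _.
  have -> : weyl_basis j = (twist_coef t j)^-1 *: twist_mps t j.
    by rewrite scalerA mulVf ?scale1r ?twist_coef_neq0.
  by apply: memvZ; apply: memvZ; apply: memv_span; exact: codom_f.
rewrite /right_normalized -[RHS](sum_scale_unitary t _ t0 weyl_basis_mul_adj).
apply: eq_bigr => j _.
by rewrite /twist_mps linearZ /= map_mxZ -scalemxAl -scalemxAr scalerA mulrC.
Qed.

(** Conjugation by unitaries with weights of sum 1 preserves multiples of the identity, so the fixed
    point does not vary with [t]; the factor 1/2 normalizes the trace. *)
Lemma fixed_point_twist_mps (t : C) : 0 < t ->
  mps_fixed_point (twist_mps t) (2^-1)%:M.
Proof.
move=> t0; split.
- move=> v; rewrite mul_mx_scalar -scalemxAl mxE mulr_ge0 ?invr_ge0// mxE.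
  by apply: sumr_ge0 => k _; rewrite !mxE mulrC mul_conjC_ge0.
- by rewrite unitmxE det_scalar unitfE expf_neq0 ?invr_eq0 ?pnatr_eq0.
- by rewrite mxtrace_scalar -[LHS]mulr_natl mulfV ?pnatr_eq0.
rewrite -[RHS]scalemx1 -(sum_scale_unitary t _ t0 weyl_basis_adj_mul) scaler_sumr.
apply: eq_bigr => j _; rewrite mul_mx_scalar /twist_mps [(_ *: _)^T]linearZ /= map_mxZ.
rewrite -!scalemxAl -scalemxAr !scalerA -mulrA; reflexivity.
Qed.

Lemma injective_product_mps : injective_mps_space product_mps.
Proof.
split.
  rewrite /injective_mps; apply/eqP; rewrite eqEsubv subvf /=; apply/subvP => M _.
  rewrite [M]mx11_scalar -scalemx1; apply: memvZ; apply: memv_span.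
  have -> : 1%:M = product_mps 0 by rewrite /product_mps eqxx.
  exact: codom_f.
rewrite /right_normalized (bigD1 0)//= big1 ?addr0.
  by rewrite /product_mps eqxx trmx1 map_mx1 mulmx1.
by move=> j /negbTE j0; rewrite /product_mps j0 mul_scalar_mx scale0r.
Qed.

Lemma fixed_point_product_mps : mps_fixed_point product_mps 1%:M.
Proof.
split.
- by move=> v; rewrite mulmx1 mxE; apply: sumr_ge0 => k _; rewrite !mxE mulrC mul_conjC_ge0.
- exact: unitmx1.
- exact: mxtrace1.
rewrite (bigD1 0)//= big1 ?addr0.
  by rewrite /product_mps eqxx trmx1 map_mx1 !mulmx1.
by move=> j /negbTE j0; rewrite /product_mps j0 mul_mx_scalar scale0r.
Qed.

Lemma cvg_twist_coef j : twist_coef t j @[t --> 0^'+] --> ((j == 0)%:R : C).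
Proof.
have t0 : (t : C) @[t --> 0^'+] --> (0 : C) by exact: cvg_within.
have t20 : 3 * (t * t) @[t --> 0^'+] --> (3 * (0 * 0) : C).
  by apply: cvgM; [exact: cvg_cst|exact: cvgM].
(* The limit is rewritten as the value of the formula at 0, to match the limit laws term by term. *)
have -> : (j == 0)%:R = (if j == 0 then 1 - 3 * (0 * 0) else 2 * 0) / (1 + 3 * (0 * 0)) :> C.
  by rewrite !mulr0 addr0 subr0 divr1; case: (j == 0).
apply: cvgM; last first.
  apply: cvgV; first by rewrite !mulr0 addr0 oner_neq0.
  by apply: cvgD => //; exact: cvg_cst.
case: (j == 0); first by apply: cvgB => //; exact: cvg_cst.
by apply: cvgM => //; exact: cvg_cst.
Qed.

Lemma cvg_twist_correlation n (F : 'I_n -> 'M[C]_4) :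
  mps_correlation (twist_mps t) (2^-1)%:M F @[t --> 0^'+] -->
  mps_correlation product_mps 1%:M F.
Proof.
(* The product tensor is traded for two copies of it on bond dimension 2; both consist of scalar
   matrices, hence have equal correlations. *)
have -> : mps_correlation product_mps 1%:M F =
    mps_correlation (fun j => (j == 0)%:R *: weyl_basis j) (2^-1)%:M F.
  rewrite (_ : (fun j => _ *: _) = (fun j => (j == 0)%:R%:M)); last first.
    apply/funext => j; have [->|] := eqVneq j 0; last by rewrite -scalemx1 !scale0r.
    by rewrite weyl_basis0 scale1r.
  rewrite !mps_correlation_scalar ?mxtrace1//.
  by rewrite mxtrace_scalar -[LHS]mulr_natl mulfV ?pnatr_eq0.
apply: cvg_mps_correlation_scale => j; first exact: cvg_twist_coef.
by apply: cvg_conjC; exact: cvg_twist_coef.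
Qed.

Lemma mps_space_identity (d chi m : nat) (K : mps_tensor C d chi) :
  (0 < chi)%N -> injective_mps_space K ->
  mps_space C d (chi + m) (mps_array 1%:M K (fun=> 0 : 'M_(m, chi))).
Proof.
move=> chi0 Ki; exists chi; first by rewrite /= chi0 leq_addr.
exists m, 1%:M, K, (fun=> 0); split=> //.
by apply/unitarymxP; rewrite trmx1 map_mx1 mulmx1.
Qed.

Lemma trace_norm_identity (d chi m : nat) (K : mps_tensor C d.+1 chi)
    (a : mps_space C d.+1 (chi + m)) :
  \val a = mps_array 1%:M K (fun=> 0 : 'M_(m, chi)) ->
  trace_norm d.+1 (chi + m) a = `|\tr (K 0)|.
Proof.
move=> aE; rewrite /trace_norm aE (trunc_array_of _ _ _ 0) invmx1 mul1mx mulmx1.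
by rewrite mxtrace_block mxtrace0 addr0.
Qed.

End SmallPerturbations.

(** * Separation of the classes while their states converge *)

Theorem mainTheorem7 (R : realType)
    (A : cstarAlgType R[i]) (site : int -> 'M[R[i]]_4 -> A)
    (site_quasilocal : quasilocal site)
    (xi : mps_quotient R[i] 4 2 -> pure_state R[i] A)
    (xi_def : forall (chi m : nat) (X : 'M[R[i]]_(chi + m))
        (K : mps_tensor R[i] 4 chi) (M : 'I_4 -> 'M[R[i]]_(m, chi))
        (a : mps_space R[i] 4 2),
      (0 < chi)%N -> (chi + m)%N = 2%N ->
      X \is unitarymx -> injective_mps_space K ->
      \val a = mps_array X K M ->
      is_mps_state site K (\val (xi (mps_class a)))) :
  ~ topological_embedding xi.
Proof.
move=> [xi_inj _ xi_open].
have idU n : (1%:M : 'M[R[i]]_n) \is unitarymx.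
  by apply/unitarymxP; rewrite trmx1 map_mx1 mulmx1.
pose a0 : mps_space R[i] 4 2 := SigSub (mem_set
  (mps_space_identity _ _ 1 _ (ltn0Sn 0) (@injective_product_mps R[i]))).
(* Injectivity of the twisted tensor is known for [0 < t < 1 / 2]; elsewhere [a0] is a default
   value. *)
have /choice[a aE] : forall t : R[i], exists b : mps_space R[i] 4 2,
    0 < t -> t < 1 / 2 ->
    \val b = mps_array 1%:M (twist_mps t) (fun=> 0 : 'M_(0, 2)).
  move=> t.
  have [[t0 t2]|nt] := pselect (0 < t /\ t < 1 / 2).
    by exists (SigSub (mem_set (mps_space_identity _ _ 0 _ (ltn0Sn 1)
      (injective_twist_mps _ t0 t2)))).
  by exists a0 => t0 t2; case: nt.
have t_small : \forall t \near 0^'+, 0 < t /\ t < 1 / 2 :> R[i].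
  near=> t; split; near: t; first exact: nbhs_right_gt.
  by apply: nbhs_right_lt; rewrite divr_gt0.
have st c : state (\val (xi c)) by have [] := set_mem (valP (xi c)).
have lim : \val (xi (mps_class (a t))) @[t --> 0^'+] --> \val (xi (mps_class a0)).
  apply: (cvg_state_local site _ _ _ _ _ site_quasilocal) => // x n F.
  rewrite (xi_def 1%N 1%N _ _ _ a0 _ _ (idU _) injective_product_mps erefl _
    fixed_point_product_mps)//.
  apply: (cvg_trans _ (@cvg_twist_correlation R[i] n F)).
  apply: near_eq_cvg; apply: filterS t_small => t [t0 t2].
  by rewrite (xi_def 2%N 0%N _ _ _ (a t) _ _ (idU _) (injective_twist_mps _ t0 t2)
    (aE t t0 t2) _ (fixed_point_twist_mps _ t0)).
(* 3/2 lies between the trace norm 1 of [a0] and the limit 2 along [a t]. *)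
pose r : R[i] := 3 / 2.
(* [B] is an open set of functionals that cuts out [V] on the pure states. *)
have [V [B Bopen BV] xiU] := xi_open _ (open_small_trace 4 2 r).
have V0 : V (xi (mps_class a0)).
  suff : (xi @` small_trace 4 2 r) (xi (mps_class a0)) by rewrite xiU => -[].
  exists (mps_class a0) => //; rewrite small_traceE.
  rewrite (@trace_norm_identity _ 3 1 1 product_mps a0 erefl).
  rewrite /product_mps eqxx mxtrace1 normr1.
  by rewrite ltr_pdivlMr// mul1r ltr_nat.
have near_small : \forall t \near 0^'+, trace_norm 4 2 (a t) < r.
  have Ba0 : B (\val (xi (mps_class a0))) by move: V0; rewrite -BV.
  have : \forall t \near 0^'+, B (\val (xi (mps_class (a t)))).
    exact: (lim _ (open_nbhs_nbhs (conj Bopen Ba0))).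
  apply: filterS => t Bt.
  have : (range xi `&` V) (xi (mps_class (a t))) by split; [exists (mps_class (a t))|rewrite -BV].
  (* Injectivity of [xi] identifies the class [c] of small trace with that of [a t]. *)
  by rewrite -xiU => -[c Uc /xi_inj cE]; move: Uc; rewrite cE small_traceE.
have near_big : \forall t \near 0^'+, r < trace_norm 4 2 (a t).
  (* The trace norm is twice the modulus of the coefficient, so the threshold is [r / 2], that is
     3/4, against the limit 1. *)
  have r2 : r / 2 < `|((0 : 'I_4) == 0)%:R : R[i]|.
    by rewrite eqxx normr1 !ltr_pdivrMr// mul1r -natrM ltr_nat.
  have big_coef : \forall t \near 0^'+, r / 2 < `|twist_coef t 0|.
    exact: cvgr_norm_gt (@cvg_twist_coef R[i] 0) _ r2.
  apply: filterS2 t_small big_coef => t [t0 t2] ct.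
  rewrite (@trace_norm_identity _ 3 2 0 (twist_mps t) (a t) (aE t t0 t2)).
  rewrite /twist_mps weyl_basis0 mxtraceZ mxtrace1 normrM normr_nat.
  by rewrite -ltr_pdivrMr.
(* The filter of positive [t] tending to 0 is proper, so some [t] meets both bounds. *)
have [t [tr rt]] := filter_ex (filterI near_small near_big).
by have := lt_trans tr rt; rewrite ltxx.
Unshelve. all: by end_near.
Qed.
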